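(* Let $(a_d)_{d\ge1}$ be a sequence of positive numbers with $a_d^{1/d}\to a$ as $d\to\infty$, where $a>1$, and let $\alpha\in(0,1)$ be fixed. For a finite nonempty set $\mathcal L_d\subset S^{d-1}$ of unit vectors in $\mathbb R^d$, let $K(\mathcal L_d,\alpha)$ denote the $(1-\alpha)$-quantile of $\sup_{\bar l\in\mathcal L_d}|\bar l^TZ|$, where $Z\sim N(0,I_d)$. Then $$\lim_{d\to\infty}\ \sup_{|\mathcal L_d|\le a_d}\ \frac{K(\mathcal L_d,\alpha)}{\sqrt d}=\Bigl(1-\frac1{a^2}\Bigr)^{1/2},$$ where for each $d$ the supremum is over all finite nonempty sets $\mathcal L_d\subset S^{d-1}$ with $|\mathcal L_d|\le a_d$.
   Context: $S^{d-1}$ is the unit sphere in $\mathbb R^d$ and $I_d$ is the $d\times d$ identity matrix (error variance known and equal to $1$). Since $a>1$, $a_d\ge1$ for all large $d$, so the supremum is over a nonempty family for all large $d$. *)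

(* Defs.v *)
From HB Require Import structures.
From mathcomp Require Import all_boot all_order all_algebra finmap.
From mathcomp Require Import all_classical all_reals all_analysis measurable_realfun.

Set Implicit Arguments.
Unset Strict Implicit.
Unset Printing Implicit Defensive.

Import Order.TTheory GRing.Theory Num.Theory.
Import numFieldNormedType.Exports.

Local Open Scope classical_set_scope.
Local Open Scope ring_scope.

Section gaussian_vector.
Context (R : realType).

Definition cons_pair (d : nat) (p : measurableTypeR R * d.-tuple R)
  : d.+1.-tuple R := [the _.-tuple _ of p.1 :: p.2].

Lemma measurable_cons_pair d : measurable_fun setT (@cons_pair d).
Proof. exact: measurable_cons. Qed.

HB.instance Definition _ d := isMeasurableFun.Build _ _ _ _ (@cons_pair d)
  (@measurable_cons_pair d).

(* The law N(0, I_d) on R^d, realised as d.-tuple R with the product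
   sigma-algebra (matrices carry no measurable structure in the library): the
   d-fold product of the standard normal law; see std_gaussian_box. *)
Fixpoint std_gaussian (d : nat) : probability (d.-tuple R) R :=
  if d is n.+1 then distribution (normal_prob 0 1 \x std_gaussian n)%E (@cons_pair n)
  else dirac [tuple].

Lemma std_gaussian_box d (B : 'I_d -> set R) :
  (forall i, measurable (B i)) ->
  std_gaussian d [set t | forall i, B i (tnth t i)] =
  (\prod_(i < d) normal_prob 0 1 (B i))%E.
Proof.
elim: d B => [|d IH] B mB /=.
  rewrite big_ord0 /dirac /= indicE mem_set//= => i.
  by case: i.
rewrite big_ord_recl -IH//.
rewrite /distribution /pushforward /=.
rewrite -product_measure1E; [|exact: mB|]; last first.
  rewrite (_ : [set _ | _] = \bigcap_(i in [set: 'I_d])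
      ((@tnth d _)^~ i @^-1` B (lift ord0 i))); last first.
    by apply/seteqP; split => t h i; [move=> _; exact: h|exact: (h i I)].
  apply: fin_bigcap_measurable => //= i _.
  by rewrite -[X in measurable X]setTI; exact: measurable_tnth.
congr (_ _); apply/seteqP; split => -[x t] /=.
  by move=> h; split => [|i]; [exact: (h ord0)|have := h (lift ord0 i); rewrite tnthS].
move=> [h0 h] i; case: (unliftP ord0 i) => [j ->|->]; last by [].
by rewrite tnthS.
Qed.

Definition vec_of_tuple (d : nat) (t : d.-tuple R) : 'cV[R]_d :=
  \col_i tnth t i.

Definition unit_sphere (d : nat) : set 'cV[R]_d :=
  [set l | \sum_(i < d) l i 0 ^+ 2 = 1].

Definition sup_abs_proj (d : nat) (L : {fset 'cV[R]_d})
    (z : d.-tuple R) : R :=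
  sup [set `|(l^T *m vec_of_tuple z) 0 0| | l in [set` L]].

Lemma sup_seqE (T : choiceType) (s : seq T) (f : T -> R) : (forall x, 0 <= f x) ->
  sup [set f x | x in [set` s]] = \big[Num.max/0]_(x <- s) f x.
Proof.
move=> f0; have ub : ubound [set f x | x in [set` s]] (\big[Num.max/0]_(x <- s) f x).
  by move=> _ [x /= xs <-]; exact: le_bigmax_seq.
have [->|s0] := eqVneq s [::].
  rewrite big_nil (_ : [set _ | _ in _] = set0) ?sup0//.
  by apply/seteqP; split => // x [].
have ne : [set f x | x in [set` s]] !=set0.
  by case: s s0 {ub} => // x s _; exists (f x); exists x => //=; rewrite mem_head.
apply/eqP; rewrite eq_le; apply/andP; split; first exact: ge_sup.
have hs : has_sup [set f x | x in [set` s]] by split=> //; eexists; exact: ub.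
rewrite big_seq; apply: bigmax_le => [|x xs].
  by case: ne => _ [x xs _]; apply: (le_trans (f0 x)); apply: sup_upper_bound => //; exists x.
by apply: sup_upper_bound => //; exists x.
Qed.

Lemma measurable_sup_abs_proj d (L : {fset 'cV[R]_d}) :
  measurable_fun setT (sup_abs_proj L).
Proof.
rewrite (_ : sup_abs_proj L =
  fun z => \big[Num.max/0]_(l <- L) `|(l^T *m vec_of_tuple z) 0 0|); last first.
  by apply/funext => z; exact: sup_seqE.
elim: (enum_fset L) => [|l s IH].
  by under eq_fun do rewrite big_nil; exact: measurable_cst.
under eq_fun do rewrite big_cons.
apply: measurable_maxr => //; apply: measurableT_comp => //.
under eq_fun do rewrite mxE.
apply: measurable_sum => i; under eq_fun do rewrite !mxE.
by apply: measurable_funM => //; exact: measurable_tnth.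
Qed.

HB.instance Definition _ d (L : {fset 'cV[R]_d}) :=
  isMeasurableFun.Build _ _ _ _ (sup_abs_proj L) (measurable_sup_abs_proj L).

End gaussian_vector.

Definition quantile disp (T : measurableType disp) (R : realType)
    (P : probability T R) (X : {RV P >-> R}) (p : R) : R :=
  inf [set t : R | (p%:E <= cdf X t)%E].

Definition K (R : realType) (d : nat) (L : {fset 'cV[R]_d}) (alpha : R) : R :=
  quantile (sup_abs_proj L : {RV std_gaussian R d >-> R}) (1 - alpha).

(* Main.v *)
Require Import Defs.
From mathcomp Require Import all_boot all_order all_algebra finmap.
From mathcomp Require Import all_classical all_reals all_analysis.
From mathcomp Require Import measurable_realfun ring lra.
Import Order.TTheory GRing.Theory Num.Theory.
Import numFieldNormedType.Exports.

(** Write Z = |Z| U.  The norm |Z| concentrates at sqrt d, and a unit vector l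
    satisfies |l . U| > k with probability (1 - k ^ 2) ^ (d / 2) up to factors
    that are subexponential in d.  A family of about a ^ d unit vectors can
    therefore bring max |l . Z| above k sqrt d with non-vanishing probability
    only if a ^ d (1 - k ^ 2) ^ (d / 2) is not exponentially small, that is, only
    if k <= c := sqrt (1 - 1 / a ^ 2), and a well-chosen family does so for every
    k < c, whatever the level alpha.

    All the probabilities come from one Gaussian integral, [integral_tilt]:
    the mass of the density exp (lam (u . t) - (s - 1) |t| ^ 2 / 2), which for a
    unit vector u does not depend on u.  Through Chernoff bounds
    ([chernoff_tilt]) it gives the concentration of the norm and the upper
    bound on caps ([dotp_tail_bound]).  It also gives the lower bound on caps
    ([typical_lower_bound]): the tilted law under which u . t is about m sqrt d
    and |t| about sqrt d concentrates on such points, and there its density is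
    controlled.

    The upper bound on K is then a union bound ([near_K_le]).  For the lower
    bound ([near_K_ge]) the vectors are chosen greedily ([greedy_cover]): by
    Tonelli some direction g / |g| covers at least half of the average fraction
    of what is still uncovered ([exists_good_direction]), so after about a ^ d
    steps almost all points of norm about sqrt d satisfy |l . z| > k sqrt d for
    some l in the family.  The probability that the maximum stays below
    k sqrt d is then below 1 - alpha, so the quantile is at least k sqrt d. *)

Set Implicit Arguments.
Unset Strict Implicit.
Unset Printing Implicit Defensive.

Local Open Scope classical_set_scope.
Local Open Scope ring_scope.

(** * Exponential moments of the Gaussian law *)

Section normal_density_integral.
Context {R : realType}.
Local Notation mu := (@lebesgue_measure R).

(** The normal law is defined by its density on events; this turns integrals
    against it into Lebesgue integrals, the normal density being one version
    of the Radon-Nikodym derivative. *)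
Lemma ge0_integral_normal_prob (m s : R) (f : R -> \bar R) :
  measurable_fun setT f -> (forall x, (0 <= f x)%E) ->
  (\int[normal_prob m s]_x f x = \int[mu]_x (f x * (normal_pdf m s x)%:E))%E.
Proof.
move=> mf f0; have dom := @normal_prob_dominates R m s.
rewrite -(Radon_Nikodym_SigmaFinite.change_of_variables dom f0 measurableT mf).
apply: ae_eq_integral => //.
- apply: emeasurable_funM => //; apply: (measurable_int mu).
  exact: Radon_Nikodym_SigmaFinite.f_integrable.
- apply: emeasurable_funM => //; apply/measurable_EFinP.
  exact: measurable_normal_pdf.
- apply: ae_eqe_mul2l; apply: integral_ae_eq => //.
  + exact: Radon_Nikodym_SigmaFinite.f_integrable.
  + by apply/measurable_EFinP; exact: measurable_normal_pdf.
  + by move=> E _ mE; rewrite -Radon_Nikodym_SigmaFinite.f_integral.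
Qed.

(** Completing the square: the integrand times the standard normal density is
    a constant multiple of the density of N(lam / s, 1 / s), which has mass 1.
    The parameter s is thus the inverse variance of the tilted law. *)
Lemma normal_exp_moment (lam s : R) : 0 < s ->
  (\int[normal_prob 0 1]_x (expR (lam * x - (s - 1) / 2 * x ^+ 2))%:E =
   (expR (lam ^+ 2 / (2 * s) - ln s / 2))%:E)%E.
Proof.
move=> s0; rewrite ge0_integral_normal_prob; last 2 first.
- apply/measurable_EFinP; apply: measurableT_comp => //.
  by apply: measurable_funB; apply: measurable_funM.
- by move=> x; rewrite lee_fin expR_ge0.
have sq0 : 0 < Num.sqrt s by rewrite sqrtr_gt0.
have sq2 : Num.sqrt s ^+ 2 = s by rewrite sqr_sqrtr// ltW.
transitivity (\int[mu]_x ((expR (lam ^+ 2 / (2 * s) - ln s / 2))%:E *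
   (normal_pdf (lam / s) (Num.sqrt s)^-1 x)%:E))%E; last first.
  rewrite integralZl//; last exact: integrable_normal_pdf.
  by rewrite integral_normal_pdf mule1.
apply: eq_integral => x _; rewrite -!EFinM; congr EFin.
rewrite !normal_pdfE ?oner_eq0 ?invr_eq0 ?gt_eqF//.
rewrite /normal_peak /normal_fun expr1n mul1r exprVn sq2 subr0.
have -> : expR (lam ^+ 2 / (2 * s) - ln s / 2) =
    expR (lam ^+ 2 / (2 * s)) / Num.sqrt s.
  rewrite expRD expRN; congr (_ / _).
  by rewrite -powR12_sqrt ?ltW// /powR gt_eqF// mulrC.
have -> : Num.sqrt (s^-1 * pi *+ 2) = Num.sqrt (pi *+ 2) / Num.sqrt s.
  have pi0 : 0 <= pi *+ 2 :> R by rewrite mulrn_wge0// pi_ge0.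
  by rewrite -mulrnAr mulrC sqrtrM// sqrtrV// ltW.
have P0 : Num.sqrt (pi *+ 2) != 0 :> R.
  by rewrite gt_eqF// sqrtr_gt0 pmulrn_lgt0// pi_gt0.
transitivity ((Num.sqrt (pi *+ 2))^-1 *
    expR ((lam ^+ 2 / (2 * s)) + - (x - lam / s) ^+ 2 / (s^-1 *+ 2))).
  rewrite mulrCA -expRD; congr (_ * expR _).
  by field; rewrite gt_eqF.
by rewrite expRD; field; rewrite P0 gt_eqF.
Qed.

End normal_density_integral.

Section std_gaussian_moments.
Context {R : realType}.

(** Independence of the coordinates, by Tonelli and induction on the
    dimension.  The one-dimensional integrals are given as reals so that the
    product is a product of reals. *)
Lemma ge0_integral_std_gaussian_prod d (f : 'I_d -> R -> R) (c : 'I_d -> R) :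
  (forall i, measurable_fun setT (f i)) -> (forall i x, 0 <= f i x) ->
  (forall i, \int[normal_prob 0 1]_x (f i x)%:E = (c i)%:E)%E ->
  (\int[std_gaussian R d]_t (\prod_(i < d) f i (tnth t i))%:E =
   (\prod_(i < d) c i)%:E)%E.
Proof.
elim: d f c => [|d IH] f c mf f0 fc.
  rewrite /= integral_dirac//= ?big_ord0 ?diracT ?mul1e//.
  by under eq_fun do rewrite big_ord0; exact: measurable_cst.
have mprod n (g : 'I_n -> R -> R) : (forall i, measurable_fun setT (g i)) ->
    measurable_fun setT (fun t : n.-tuple R => (\prod_(i < n) g i (tnth t i))%:E).
  move=> mg; apply/measurable_EFinP; apply: measurable_prod => i _.
  by apply: measurableT_comp => //; exact: measurable_tnth.
have prod0 n (g : 'I_n -> R -> R) (t : n.-tuple R) : (forall i x, 0 <= g i x) ->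
    (0 <= (\prod_(i < n) g i (tnth t i))%:E)%E.
  by move=> g0; rewrite lee_fin prodr_ge0.
rewrite [LHS]ge0_integral_distribution; last 2 first.
- exact: mprod.
- by move=> t; exact: prod0.
rewrite fubini_tonelli1/=; last 2 first.
- by apply: measurableT_comp; [exact: mprod|exact: measurable_cons_pair].
- by move=> t; exact: prod0.
rewrite big_ord_recl EFinM -fc.
rewrite /fubini_F/=.
transitivity (\int[normal_prob 0 1]_x ((f ord0 x)%:E *
   (\prod_(i < d) c (lift ord0 i))%:E))%E.
  apply: eq_integral => x _.
  rewrite -(IH (fun i => f (lift ord0 i)))//.
  rewrite -ge0_integralZl//; last 3 first.
  - exact: (mprod _ (fun i => f (lift ord0 i))).
  - by move=> t _; exact: (prod0 _ (fun i => f (lift ord0 i))).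
  - by rewrite lee_fin.
  apply: eq_integral => t _; rewrite -EFinM big_ord_recl; congr (_ * _)%:E.
  by apply: eq_bigr => i _; rewrite tnthS.
rewrite ge0_integralZr//.
- by apply/measurable_EFinP; exact: mf.
- by move=> x _; rewrite lee_fin.
rewrite lee_fin prodr_ge0// => i _; rewrite -lee_fin -fc integral_ge0// => x _.
by rewrite lee_fin.
Qed.

Definition dotp d (u : 'I_d -> R) (t : d.-tuple R) : R :=
  \sum_(i < d) u i * tnth t i.

Definition sqnorm d (t : d.-tuple R) : R := \sum_(i < d) tnth t i ^+ 2.

Lemma measurable_dotp d (u : 'I_d -> R) : measurable_fun setT (dotp u).
Proof.
apply: measurable_sum => i; apply: measurable_funM => //.
exact: measurable_tnth.
Qed.

Lemma measurable_sqnorm d : measurable_fun setT (@sqnorm d).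
Proof.
apply: measurable_sum => i; apply: measurable_funX; exact: measurable_tnth.
Qed.

(** Density, up to normalisation, of N((lam / s) u, (1 / s) I_d) with respect
    to N(0, I_d). *)
Definition tilt d (u : 'I_d -> R) (lam s : R) (t : d.-tuple R) : R :=
  expR (lam * dotp u t - (s - 1) / 2 * sqnorm t).

Lemma measurable_tilt d (u : 'I_d -> R) lam s : measurable_fun setT (tilt u lam s).
Proof.
apply: measurableT_comp => //; apply: measurable_funB; apply: measurable_funM => //.
- exact: measurable_dotp.
- exact: measurable_sqnorm.
Qed.

(** Total mass of [tilt u lam s] for a unit vector u, see [integral_tilt]; it
    is written as one exponential so that masses can be compared through
    their exponents. *)
Definition tilt_mass (d : nat) (lam s : R) : R :=
  expR (lam ^+ 2 / (2 * s) - d%:R / 2 * ln s).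

(** The tilt factors over the coordinates, and the mass depends on u only
    through its norm: this replaces rotation invariance of the Gaussian law
    in all that follows. *)
Lemma integral_tilt d (u : 'I_d -> R) lam s : 0 < s -> \sum_(i < d) u i ^+ 2 = 1 ->
  (\int[std_gaussian R d]_t (tilt u lam s t)%:E = (tilt_mass d lam s)%:E)%E.
Proof.
move=> s0 u1.
have tE t : tilt u lam s t =
    \prod_(i < d) expR (lam * u i * tnth t i - (s - 1) / 2 * tnth t i ^+ 2).
  rewrite /tilt /dotp /sqnorm !mulr_sumr -sumrB expR_sum; apply: eq_bigr => i _.
  by rewrite mulrA.
under eq_integral do rewrite tE.
rewrite (@ge0_integral_std_gaussian_prod _
  (fun i x => expR (lam * u i * x - (s - 1) / 2 * x ^+ 2))
  (fun i => expR ((lam * u i) ^+ 2 / (2 * s) - ln s / 2))).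
- rewrite -expR_sum sumrB; congr (expR _)%:E; congr (_ - _).
    rewrite -mulr_suml; under eq_bigr do rewrite exprMn.
    by rewrite -mulr_sumr u1 mulr1.
  by rewrite sumr_const card_ord -mulr_natl; ring.
- move=> i; apply: measurableT_comp => //.
  by apply: measurable_funB; apply: measurable_funM.
- by move=> i x; exact: expR_ge0.
- by move=> i; exact: normal_exp_moment.
Qed.

End std_gaussian_moments.

(** * Chernoff bounds and concentration of tilted laws *)

Section chernoff.
Context {R : realType}.

(** Exponential Markov inequality between two tilts.  With lam = 0 and s = 1
    the left side is the Gaussian measure of E; with other values it bounds
    the tails of a tilted law. *)
Lemma chernoff_tilt d (u : 'I_d -> R) (lam s lam' s' b : R)
    (E : set (d.-tuple R)) :
  measurable E -> \sum_(i < d) u i ^+ 2 = 1 -> 0 < s' ->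
  (forall t, E t -> lam * dotp u t - (s - 1) / 2 * sqnorm t + b <=
                    lam' * dotp u t - (s' - 1) / 2 * sqnorm t) ->
  (\int[std_gaussian R d]_(t in E) (tilt u lam s t)%:E <=
   (expR (- b) * tilt_mass d lam' s')%:E)%E.
Proof.
move=> mE u1 s'0 Eb.
have mt l k : measurable_fun setT (fun t : d.-tuple R => (tilt u l k t)%:E).
  by apply/measurable_EFinP; exact: measurable_tilt.
have t0 l k (t : d.-tuple R) : (0 <= (tilt u l k t)%:E)%E.
  by rewrite lee_fin expR_ge0.
apply: (@le_trans _ _ (\int[std_gaussian R d]_(t in E)
    (expR (- b) * tilt u lam' s' t)%:E)%E).
  apply: ge0_le_integral => //.
  - exact: measurable_funTS.
  - apply: measurable_funTS; apply/measurable_EFinP.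
    by apply: measurable_funM => //; exact: measurable_tilt.
  - move=> t Et; rewrite lee_fin -expRD ler_expR.
    by rewrite [leRHS]addrC lerBrDr; exact: Eb.
apply: (@le_trans _ _ (\int[std_gaussian R d]_t
    (expR (- b) * tilt u lam' s' t)%:E)%E).
  apply: ge0_subset_integral => //.
  - apply/measurable_EFinP.
    by apply: measurable_funM => //; exact: measurable_tilt.
  - by move=> t _; rewrite lee_fin mulr_ge0 ?expR_ge0.
rewrite EFinM -(integral_tilt _ s'0 u1) -ge0_integralZl//.
Qed.

End chernoff.

Lemma ge0_integral_setU_le d (T : measurableType d) (R : realType)
    (mu : {measure set T -> \bar R}) (A B : set T) (f : T -> \bar R) :
  measurable A -> measurable B -> measurable_fun setT f ->
  (forall x, (0 <= f x)%E) ->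
  (\int[mu]_(x in A `|` B) f x <= \int[mu]_(x in A) f x + \int[mu]_(x in B) f x)%E.
Proof.
move=> mA mB mf f0.
have -> : A `|` B = A `|` (B `\` A).
  by apply/seteqP; split => x /=; have := pselect (A x); tauto.
rewrite ge0_integral_setU//; last 3 first.
- exact: measurableD.
- exact: measurable_funTS.
- by apply/disj_setPS => x [Ax []].
rewrite leeD2l//; apply: ge0_subset_integral => //.
- exact: measurableD.
- exact: measurable_funTS.
Qed.

Lemma measurable_set_le d (T : measurableType d) (R : realType) (f g : T -> R) :
  measurable_fun setT f -> measurable_fun setT g ->
  measurable [set x | f x <= g x].
Proof.
by move=> mf mg; rewrite -[X in measurable X]setTI; exact: measurable_fun_le.
Qed.

Lemma measurable_set_lt d (T : measurableType d) (R : realType) (f g : T -> R) :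
  measurable_fun setT f -> measurable_fun setT g ->
  measurable [set x | f x < g x].
Proof.
move=> mf mg; rewrite (_ : mkset _ = ~` [set x | g x <= f x]).
  by apply: measurableC; exact: measurable_set_le.
by apply/seteqP; split => x /=; [rewrite ltNge => /negP|move/negP; rewrite -ltNge].
Qed.

Section tilted.
Context {R : realType}.
(** The Gaussian law tilted with this inverse variance and with mean m sqrt d
    along u has typical squared norm about (m ^ 2 + 1 / s) d = d, the same as
    the Gaussian law itself. *)
Definition tilt_var_inv (m : R) : R := (1 - m ^+ 2)^-1.

Section tilted_concentration.
Variables (m : R).
Hypotheses (m0 : 0 <= m) (m1 : m < 1).
Local Notation s := (tilt_var_inv m).

Lemma onem_sqr_gt0 : 0 < 1 - m ^+ 2.
Proof. by rewrite subr_gt0 expr_lt1. Qed.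

Lemma tilt_var_inv_gt0 : 0 < s.
Proof. by rewrite invr_gt0 onem_sqr_gt0. Qed.

Lemma tilt_var_invM : s * m ^+ 2 = s - 1.
Proof.
have := onem_sqr_gt0; rewrite /tilt_var_inv => h.
by field; rewrite gt_eqF.
Qed.

Definition dotp_tail d (u : 'I_d -> R) (eta sg : R) : set (d.-tuple R) :=
  [set t | eta * Num.sqrt d%:R <= sg * (dotp u t - m * Num.sqrt d%:R)].

Definition sqnorm_tail d (th : R) : set (d.-tuple R) :=
  [set t | 0 <= th * (sqnorm t - d%:R * (1 + 2 * th))].

Lemma measurable_dotp_tail d (u : 'I_d -> R) eta sg :
  measurable (dotp_tail u eta sg).
Proof.
have mf : measurable_fun setT
    (fun t : d.-tuple R => sg * (dotp u t - m * Num.sqrt d%:R)).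
  by apply: measurable_funM => //; apply: measurable_funB => //; exact: measurable_dotp.
exact: measurable_set_le.
Qed.

Lemma measurable_sqnorm_tail d th : measurable (@sqnorm_tail d th).
Proof.
have mf : measurable_fun setT
    (fun t : d.-tuple R => th * (sqnorm t - d%:R * (1 + 2 * th))).
  by apply: measurable_funM => //; apply: measurable_funB => //; exact: measurable_sqnorm.
exact: measurable_set_le.
Qed.

(** The sign sg treats the two tails at once.  The Chernoff exponent is
    optimal when the mean along u is moved from m sqrt d to
    (m + sg eta) sqrt d, with unchanged variance. *)
Lemma tilt_dotp_tail d (u : 'I_d -> R) (eta sg : R) :
  \sum_(i < d) u i ^+ 2 = 1 -> 0 <= eta -> sg ^+ 2 = 1 ->
  (\int[std_gaussian R d]_(t in dotp_tail u eta sg)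
     (tilt u (s * m * Num.sqrt d%:R) s t)%:E
   <= (expR (- (s * eta ^+ 2 / 2) * d%:R) *
       tilt_mass d (s * m * Num.sqrt d%:R) s)%:E)%E.
Proof.
rewrite /dotp_tail => u1 eta0 sg2; have s0 := tilt_var_inv_gt0.
set q := Num.sqrt d%:R; have q2 : q ^+ 2 = d%:R by rewrite sqr_sqrtr.
have q0 : 0 <= q by exact: sqrtr_ge0.
apply: le_trans (@chernoff_tilt _ _ _ _ _ (s * (m + sg * eta) * q) s
  (s * eta * q * ((sg * m + eta) * q)) _ _ u1 s0 _) _.
- exact: measurable_dotp_tail.
- move=> t /= ht; rewrite addrAC lerD2r.
  have := ler_wpM2l (mulr_ge0 (mulr_ge0 (ltW s0) eta0) q0) ht.
  rewrite -subr_ge0 => h; rewrite -subr_ge0; apply: le_trans h _.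
  rewrite le_eqVlt; apply/orP; left; apply/eqP.
  by ring: sg2.
rewrite /tilt_mass -!expRD lee_fin ler_expR le_eqVlt; apply/orP; left; apply/eqP.
rewrite -q2; field: sg2.
by rewrite gt_eqF.
Qed.

(** The sign of th chooses the tail, which is the upper one for th > 0.
    Dividing the inverse variance s by 1 + th raises the log-mass by at most
    d s th / 2 (because ln (1 + th) <= th), while the tilt grows on the event
    by at least (d s th / 2) (1 + 2 th) / (1 + th) in the exponent; the first
    order terms cancel and a rate quadratic in th is left. *)
Lemma tilt_sqnorm_tail d (u : 'I_d -> R) (th : R) :
  \sum_(i < d) u i ^+ 2 = 1 -> - 1 < th ->
  (\int[std_gaussian R d]_(t in @sqnorm_tail d th)
     (tilt u (s * m * Num.sqrt d%:R) s t)%:E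
   <= (expR (- (s * th ^+ 2 / (2 * (1 + th))) * d%:R) *
       tilt_mass d (s * m * Num.sqrt d%:R) s)%:E)%E.
Proof.
rewrite /sqnorm_tail => u1 th1; have s0 := tilt_var_inv_gt0.
have th1' : 0 < 1 + th by rewrite addrC -ltrBlDr sub0r.
set q := Num.sqrt d%:R; have q2 : q ^+ 2 = d%:R by rewrite sqr_sqrtr.
apply: le_trans (@chernoff_tilt _ _ _ _ _ (s * m * q) (s / (1 + th))
  (s * th / (1 + th) / 2 * (d%:R * (1 + 2 * th))) _ _ u1 _ _) _.
- exact: measurable_sqnorm_tail.
- by rewrite divr_gt0.
- move=> t /= ht; rewrite -addrA lerD2l.
  have c0 : 0 <= s / (1 + th) / 2 by rewrite !divr_ge0// ltW.
  have := mulr_ge0 c0 ht => h; rewrite -subr_ge0; apply: le_trans h _.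
  rewrite le_eqVlt; apply/orP; left; apply/eqP.
  by field; rewrite gt_eqF.
rewrite /tilt_mass -!expRD lee_fin ler_expR.
have lnE : ln (s / (1 + th)) = ln s - ln (1 + th).
  by rewrite ln_div// posrE.
have lnth : ln (1 + th) <= th by rewrite le_ln1Dx.
rewrite lnE.
have d0 : 0 <= d%:R / 2 :> R by rewrite divr_ge0.
have h := ler_wpM2l d0 lnth.
rewrite -subr_ge0; rewrite -subr_ge0 in h; apply: le_trans h _.
rewrite le_eqVlt; apply/orP; left; apply/eqP.
rewrite -q2.
have sm : s * m ^+ 2 = s - 1 := tilt_var_invM.
have -> : (s * m * q) ^+ 2 / (2 * s) = (s - 1) * q ^+ 2 / 2.
  by rewrite -sm; field; rewrite gt_eqF.
have -> : (s * m * q) ^+ 2 / (2 * (s / (1 + th))) = (s - 1) * (1 + th) * q ^+ 2 / 2.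
  by rewrite -sm; field; rewrite !gt_eqF.
by field; rewrite !gt_eqF.
Qed.

Definition typical d (u : 'I_d -> R) (eta : R) : set (d.-tuple R) :=
  [set t | `|dotp u t - m * Num.sqrt d%:R| < eta * Num.sqrt d%:R /\
           `|sqnorm t - d%:R| < eta * d%:R].

Lemma measurable_typical d (u : 'I_d -> R) eta : measurable (typical u eta).
Proof.
apply: measurableI; apply: measurable_set_lt => //;
  apply: measurableT_comp => //; apply: measurable_funB => //.
- exact: measurable_dotp.
- exact: measurable_sqnorm.
Qed.

Lemma atypical_sub d (u : 'I_d -> R) (eta : R) : 0 < eta ->
  ~` typical u eta `<=` dotp_tail u eta 1 `|` dotp_tail u eta (- 1) `|`
    (@sqnorm_tail d (eta / 2) `|` @sqnorm_tail d (- (eta / 2))).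
Proof.
move=> eta0 t /not_andP[] /negP; rewrite -leNgt => ht.
  left; rewrite /dotp_tail /= mul1r mulN1r.
  by move: ht; rewrite ler_normr => /orP[]; [left|right].
right; rewrite /sqnorm_tail /=.
move: ht; rewrite ler_normr => /orP[]; [left|right].
  apply: mulr_ge0; first by rewrite divr_ge0// ltW.
  by rewrite [eta / 2]mulrC mulrA divff// mul1r; lra.
rewrite mulNr -mulrN; apply: mulr_ge0; first by rewrite divr_ge0// ltW.
by lra.
Qed.

(** The tilted law gives the atypical points an exponentially small share of
    its mass, uniformly in the direction u: four tails, with th = eta / 2 and
    th = - eta / 2 for the norm.  The rate s eta ^ 2 / 12 is below all
    four rates. *)
Lemma tilt_atypical (eta : R) : 0 < eta -> eta < 1 ->
  exists2 r : R, 0 < r & forall d (u : 'I_d -> R), \sum_(i < d) u i ^+ 2 = 1 ->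
  (\int[std_gaussian R d]_(t in ~` typical u eta)
      (tilt u (s * m * Num.sqrt d%:R) s t)%:E
   <= (4 * expR (- r * d%:R) * tilt_mass d (s * m * Num.sqrt d%:R) s)%:E)%E.
Proof.
move=> eta0 eta1; have s0 := tilt_var_inv_gt0.
exists (s * eta ^+ 2 / 12); first by rewrite divr_gt0// mulr_gt0// exprn_gt0.
move=> d u u1.
set M := tilt_mass _ _ _; set r := _ / 12.
have M0 : 0 < M by exact: expR_gt0.
set f := fun t => (tilt u _ s t)%:E.
have mf A : measurable_fun A f.
  by apply: measurable_funTS; apply/measurable_EFinP; exact: measurable_tilt.
have f0 t : (0 <= f t)%E by rewrite lee_fin expR_ge0.
have weaken r' : r <= r' -> ((expR (- r' * d%:R) * M)%:E <= (expR (- r * d%:R) * M)%:E)%E.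
  move=> rr'; rewrite lee_fin ler_pM2r// ler_expR ler_wpM2r//.
  by rewrite lerN2.
have c2 : 0 <= s * eta ^+ 2 by rewrite mulr_ge0 ?sqr_ge0// ltW.
have bnd th : - 1 < th -> th <= 2^-1 -> r <= s * (eta / 2) ^+ 2 / (2 * (1 + th)).
  move=> th1 th2; rewrite ler_pdivlMr; last by lra.
  rewrite -subr_ge0 (_ : _ - _ = s * eta ^+ 2 * ((1 - 2 * th) / 12)).
    by apply: mulr_ge0 => //; lra.
  by rewrite /r; field.
have mD := @measurable_dotp_tail d u eta; have mN := @measurable_sqnorm_tail d.
apply: (@le_trans _ _ (\int[std_gaussian R d]_(t in dotp_tail u eta 1 `|`
    dotp_tail u eta (- 1) `|`
    (@sqnorm_tail d (eta / 2) `|` @sqnorm_tail d (- (eta / 2)))) f t))%E.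
  apply: ge0_subset_integral => //.
  - by apply: measurableC; exact: measurable_typical.
  - by apply: measurableU; apply: measurableU.
  - by move=> t _; exact: f0.
  - exact: atypical_sub.
apply: le_trans (ge0_integral_setU_le _ _ _ _ _) _ => //; try exact: measurableU.
rewrite (_ : 4 * _ * M = (expR (- r * d%:R) * M + expR (- r * d%:R) * M) +
  (expR (- r * d%:R) * M + expR (- r * d%:R) * M)); last by ring.
rewrite !EFinD; apply: leeD; (apply: le_trans (ge0_integral_setU_le _ _ _ _ _) _ => //);
  apply: leeD.
- apply: le_trans (tilt_dotp_tail u1 (ltW eta0) _) (weaken _ _); first by rewrite expr1n.
  by rewrite ler_wpM2l// lef_pV2 ?posrE//; lra.
- apply: le_trans (tilt_dotp_tail u1 (ltW eta0) _) (weaken _ _); first by rewrite sqrrN expr1n.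
  by rewrite ler_wpM2l// lef_pV2 ?posrE//; lra.
- apply: le_trans (tilt_sqnorm_tail u1 _) (weaken _ _); first by lra.
  by apply: bnd; lra.
- apply: le_trans (tilt_sqnorm_tail u1 _) (weaken _ _); first by lra.
  by rewrite sqrrN; apply: bnd; lra.
Qed.

End tilted_concentration.
End tilted.

(** * Gaussian measure of spherical caps *)

Section gaussian_estimates.
Context {R : realType}.

Lemma sum_sqr_delta d (j : 'I_d) : \sum_(i < d) ((i == j)%:R : R) ^+ 2 = 1.
Proof.
rewrite (bigD1 j)// eqxx expr1n/= big1 ?addr0// => i /negbTE ->.
by rewrite expr0n.
Qed.

Lemma tilt01 d (u : 'I_d -> R) t : tilt u 0 1 t = 1.
Proof. by rewrite /tilt mul0r subrr !mul0r subr0 expR0. Qed.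

Lemma integral_tilt01 d (u : 'I_d -> R) (A : set (d.-tuple R)) : measurable A ->
  (\int[std_gaussian R d]_(t in A) (tilt u 0 1 t)%:E = std_gaussian R d A)%E.
Proof.
move=> mA; under eq_integral do rewrite tilt01.
by rewrite integral_cst// mul1e.
Qed.

Lemma tilt_var_inv0 : tilt_var_inv 0 = 1 :> R.
Proof. by rewrite /tilt_var_inv expr0n/= subr0 invr1. Qed.

Lemma measurable_sqnorm_near d (eta : R) :
  measurable [set t : d.-tuple R | `|sqnorm t - d%:R| < eta * d%:R].
Proof.
apply: measurable_set_lt => //; apply: measurableT_comp => //.
by apply: measurable_funB => //; exact: measurable_sqnorm.
Qed.

(** Case m = 0 of [tilt_atypical], where the tilted law is the Gaussian law
    itself; the direction is then arbitrary. *)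
Lemma sqnorm_concentration (eta : R) : 0 < eta -> eta < 1 ->
  exists2 r : R, 0 < r & forall d, (0 < d)%N ->
  (std_gaussian R d (~` [set t | (`|sqnorm t - d%:R| < eta * d%:R)%R])
   <= (4 * expR (- r * d%:R))%:E)%E.
Proof.
move=> eta0 eta1; have [r r0 hr] := tilt_atypical (lexx 0) ltr01 eta0 eta1.
exists r => // -[//|d] _; pose u (i : 'I_d.+1) : R := (i == ord0)%:R.
have u1 : \sum_(i < d.+1) u i ^+ 2 = 1 by exact: sum_sqr_delta.
have := hr _ u u1; rewrite tilt_var_inv0 mulr0 mul0r /tilt_mass expr0n mul0r.
rewrite ln1 mulr0 subrr expR0 mulr1 integral_tilt01; last first.
  by apply: measurableC; exact: measurable_typical.
apply: le_trans; apply: le_measure; rewrite ?inE.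
- by apply: measurableC; exact: measurable_sqnorm_near.
- by apply: measurableC; exact: measurable_typical.
- by apply: subsetC => t [].
Qed.

(** In effect the measure of a spherical cap, from above: for rho = 1 the
    bound is (1 - kappa ^ 2) ^ (d / 2).  The tilt used in the Chernoff bound is the one
    under which the event is typical, so nothing is lost in the rate. *)
Lemma dotp_tail_bound d (u : 'I_d -> R) (kappa rho : R) :
  \sum_(i < d) u i ^+ 2 = 1 -> 0 <= kappa -> kappa < 1 ->
  (std_gaussian R d [set t | (kappa * Num.sqrt d%:R <= dotp u t)%R /\
                             (sqnorm t <= rho * d%:R)%R]
   <= (expR (d%:R / 2 * ((tilt_var_inv kappa - 1) * (rho - 1) +
                          ln (1 - kappa ^+ 2))))%:E)%E.
Proof.
move=> u1 k0 k1; have s0 := tilt_var_inv_gt0 k0 k1.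
have sk := tilt_var_invM k0 k1.
have lns : ln (1 - kappa ^+ 2) = - ln (tilt_var_inv kappa).
  by rewrite lnV ?opprK// posrE onem_sqr_gt0.
rewrite lns; set s := tilt_var_inv kappa in s0 sk *.
set q := Num.sqrt d%:R; have q2 : q ^+ 2 = d%:R by rewrite sqr_sqrtr.
have q0 : 0 <= q by exact: sqrtr_ge0.
have mE : measurable [set t : d.-tuple R | kappa * q <= dotp u t /\
    sqnorm t <= rho * d%:R].
  apply: measurableI; apply: measurable_set_le => //.
  - exact: measurable_dotp.
  - exact: measurable_sqnorm.
rewrite -(integral_tilt01 u mE).
have := @chernoff_tilt _ _ u 0 1 (kappa * q * s) s
  (kappa ^+ 2 * d%:R * s - (s - 1) / 2 * rho * d%:R) _ mE u1 s0.
move=> /(_ _)/le_trans; apply.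
- move=> t [h1 h2]; rewrite subrr !mul0r subrr add0r lerB//.
    have kqs : 0 <= kappa * q * s by rewrite !mulr_ge0// ltW.
    apply: le_trans (ler_wpM2l kqs h1); rewrite -q2 le_eqVlt; apply/orP; left.
    by apply/eqP; ring.
  rewrite -[leRHS]mulrA ler_wpM2l// divr_ge0// -sk mulr_ge0 ?sqr_ge0//.
  exact: ltW.
- rewrite /tilt_mass -expRD lee_fin ler_expR le_eqVlt; apply/orP; left; apply/eqP.
  rewrite -q2.
  have -> : (kappa * q * s) ^+ 2 / (2 * s) = (s * kappa ^+ 2) * q ^+ 2 / 2.
    by field; rewrite gt_eqF.
  have -> : kappa ^+ 2 * q ^+ 2 * s = (s * kappa ^+ 2) * q ^+ 2 by ring.
  by rewrite sk; field.
Qed.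

(** The matching bound from below, by change of measure: at least half of the
    tilted mass lies on the typical set, where the tilt is at most W, so the
    Gaussian measure of that set is at least M / (2 W). *)
Lemma typical_lower_bound (m eta : R) : 0 <= m -> m < 1 -> 0 < eta -> eta < 1 ->
  \forall d \near \oo, forall u : 'I_d -> R, \sum_(i < d) u i ^+ 2 = 1 ->
  ((2^-1 * expR (d%:R * (ln (1 - m ^+ 2) / 2 -
       tilt_var_inv m * eta * (m + m ^+ 2 / 2))))%:E <=
   std_gaussian R d (typical m u eta))%E.
Proof.
move=> m0 m1 eta0 eta1; have [r r0 hr] := tilt_atypical m0 m1 eta0 eta1.
have s0 := tilt_var_inv_gt0 m0 m1; have sm := tilt_var_invM m0 m1.
have lns : ln (1 - m ^+ 2) = - ln (tilt_var_inv m).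
  by rewrite lnV ?opprK// posrE onem_sqr_gt0.
near=> d => u u1.
have hd : 4 * expR (- r * d%:R) <= 2^-1.
  rewrite mulNr expRN -ler_pdivlMl// -invfM lef_pV2 ?posrE ?expR_gt0//.
  apply: le_trans (expR_ge1Dx _).
  rewrite -lerBlDl -ler_pdivrMl//.
  by near: d; exact: nbhs_infty_ger.
have mT := measurable_typical m u eta.
pose q : R := Num.sqrt d%:R; have q2 : q ^+ 2 = d%:R by rewrite sqr_sqrtr.
have q0 : 0 <= q by exact: sqrtr_ge0.
move: (hr d u u1); rewrite -/q lns.
set s := tilt_var_inv m in s0 sm *; set M := tilt_mass _ _ _.
set T := typical m u eta in mT *.
set p := fine (std_gaussian R d T).
have pE : std_gaussian R d T = p%:E by rewrite fineK// fin_num_measure.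
(* upper bound for the tilt on the typical set *)
pose W := expR (s * m * q * ((m + eta) * q) - (s - 1) / 2 * ((1 - eta) * d%:R)).
have W0 : 0 < W by exact: expR_gt0.
have M0 : 0 < M by exact: expR_gt0.
have mt : measurable_fun setT (fun t : d.-tuple R => (tilt u (s * m * q) s t)%:E).
  by apply/measurable_EFinP; exact: measurable_tilt.
have Wle : (\int[std_gaussian R d]_(t in T) (tilt u (s * m * q) s t)%:E <= (W * p)%:E)%E.
  rewrite EFinM -pE -integral_cst//; apply: ge0_le_integral => //=.
  - by move=> t _; rewrite lee_fin expR_ge0.
  - exact: measurable_funTS.
  - move=> t [h1 h2]; rewrite lee_fin ler_expR lerB//.
      rewrite ler_wpM2l ?mulr_ge0 ?(ltW s0)//.
      by move: h1; rewrite ltr_distl => /andP[_]; rewrite mulrDl => /ltW.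
    rewrite ler_wpM2l ?divr_ge0 -?sm ?mulr_ge0 ?sqr_ge0 ?(ltW s0)//.
    by move: h2; rewrite ltr_distl => /andP[/ltW]; rewrite mulrBl mul1r.
move=> hat.
have : (M%:E <= (W * p)%:E + (4 * expR (- r * d%:R) * M)%:E)%E.
  rewrite -(integral_tilt _ s0 u1) -/q -(setUv T) ge0_integral_setU//.
  - exact: leeD.
  - exact: measurableC.
  - by rewrite setUv.
  - by move=> t _; rewrite lee_fin expR_ge0.
  - by apply/disj_setPCl.
rewrite -EFinD lee_fin => Mle.
have {}Mle : M / 2 <= W * p.
  have := ler_wpM2r (ltW M0) hd; move: Mle; lra.
rewrite pE lee_fin -(ler_pM2l W0); apply: le_trans Mle.
rewrite mulrCA [M / 2]mulrC ler_wpM2l// /W /M /tilt_mass -expRD ler_expR.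
rewrite le_eqVlt; apply/orP; left; apply/eqP.
rewrite -q2.
have -> : (s * m * q) ^+ 2 / (2 * s) = (s * m ^+ 2) * q ^+ 2 / 2.
  by field; rewrite gt_eqF.
have -> : s * m * q * ((m + eta) * q) = (s * m ^+ 2) * q ^+ 2 + s * m * eta * q ^+ 2.
  by ring.
have -> : s * eta * (m + m ^+ 2 / 2) = s * eta * m + (s * m ^+ 2) * eta / 2.
  by field.
by rewrite sm; field.
Unshelve. all: by end_near. Qed.

End gaussian_estimates.

(** * Quantiles of the maximal projection *)

Section quantile_bounds.
Context {R : realType}.

Lemma sup_abs_proj_le d (L : {fset 'cV[R]_d}) (z : d.-tuple R) (t : R) : 0 <= t ->
  sup_abs_proj L z <= t <->
  forall l, l \in L -> `|dotp (fun i => l i 0) z| <= t.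
Proof.
move=> t0.
have E (l : 'cV[R]_d) : (l^T *m vec_of_tuple z) 0 0 = dotp (fun i => l i 0) z.
  by rewrite mxE; apply: eq_bigr => i _; rewrite !mxE.
rewrite /sup_abs_proj (sup_seqE _ (f := fun l : 'cV[R]_d => `|(l^T *m vec_of_tuple z) 0 0|))//.
split => [h l lL|h].
  rewrite -E; apply: (le_trans _ h).
  pose f (x : 'cV[R]_d) : R := `|(x^T *m vec_of_tuple z) 0 0|.
  exact: (@le_bigmax_seq _ _ _ _ 0 l xpredT f lL isT).
rewrite big_seq; apply: bigmax_le => // l lL; rewrite E; exact: h.
Qed.

Lemma sup_abs_proj_ge0 d (L : {fset 'cV[R]_d}) (z : d.-tuple R) : 0 <= sup_abs_proj L z.
Proof.
rewrite /sup_abs_proj (sup_seqE _ (f := fun l : 'cV[R]_d => `|(l^T *m vec_of_tuple z) 0 0|))//.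
exact: bigmax_ge_id.
Qed.

Lemma measurable_uncovered d (L : {fset 'cV[R]_d}) (t : R) :
  measurable [set z | sup_abs_proj L z <= t].
Proof. exact: measurable_set_le. Qed.

Lemma cdf_sup_abs_proj d (L : {fset 'cV[R]_d}) (t : R) :
  cdf (sup_abs_proj L : {RV std_gaussian R d >-> R}) t =
  std_gaussian R d [set z | sup_abs_proj L z <= t].
Proof. by rewrite /cdf /distribution /pushforward; congr (std_gaussian R d _). Qed.

(** The set whose infimum is K L alpha is bounded below by 0, since the cdf
    vanishes on negative reals while 1 - alpha > 0. *)
Lemma K_le d (L : {fset 'cV[R]_d}) (alpha t : R) : alpha < 1 ->
  ((1 - alpha)%:E <= std_gaussian R d [set z | (sup_abs_proj L z <= t)%R])%E ->
  K L alpha <= t.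
Proof.
move=> a1 h; apply: ge_inf; last by rewrite /= cdf_sup_abs_proj.
exists 0 => r /=; rewrite cdf_sup_abs_proj => hr; rewrite leNgt; apply/negP => r0.
move: hr; rewrite (_ : mkset _ = set0) ?measure0 ?lee_fin ?leNgt ?subr_gt0 ?a1//.
apply/seteqP; split => z //= hz.
by have := lt_le_trans r0 (le_trans (sup_abs_proj_ge0 L z) hz); rewrite ltxx.
Qed.

(** Here 1 - alpha < 1 matters: it makes the set whose infimum is K L alpha
    nonempty. *)
Lemma K_ge d (L : {fset 'cV[R]_d}) (alpha t : R) : 0 < alpha ->
  (std_gaussian R d [set z | (sup_abs_proj L z <= t)%R] < (1 - alpha)%:E)%E ->
  t <= K L alpha.
Proof.
move=> a0 h; apply: lb_le_inf.
  have c1 := cvg_cdfy1 (sup_abs_proj L : {RV std_gaussian R d >-> R}).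
  have /c1 : nbhs (1%:E : \bar R) [set y | ((1 - alpha)%:E < y)%E].
    by apply: open_nbhs_nbhs; split; [exact: open_ereal_gt_ereal|rewrite /= lte_fin gtrBl].
  by move=> [M [_ hM]]; exists (M + 1) => /=; apply/ltW/hM; rewrite ltrDl.
move=> r /=; rewrite cdf_sup_abs_proj => hr; rewrite leNgt; apply/negP => rt.
have := lt_le_trans h hr; rewrite ltNge => /negP; apply.
apply: le_measure; rewrite ?inE; try exact: measurable_uncovered.
by move=> z /= hz; apply: le_trans hz (ltW rt).
Qed.

End quantile_bounds.

(** * Covering by random directions *)

Section covering.
Context {R : realType}.

Lemma measure_exists_seq_le d (T : measurableType d) (P : probability T R)
    (I : choiceType) (s : seq I) (A : I -> set T) (c : R) :
  (forall i, measurable (A i)) -> (forall i, i \in s -> (P (A i) <= c%:E)%E) ->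
  measurable [set x | exists2 i, i \in s & A i x] /\
  (P [set x | exists2 i, i \in s & A i x] <= ((size s)%:R * c)%:E)%E.
Proof.
move=> mA; elim: s => [|i s IH] Ac.
  rewrite (_ : mkset _ = set0); last by apply/seteqP; split => // x [].
  by rewrite measure0 mul0r.
have [|mS le_S] := IH; first by move=> j js; apply: Ac; rewrite inE js orbT.
rewrite (_ : mkset _ = A i `|` [set x | exists2 i, i \in s & A i x]); last first.
  apply/seteqP; split => x /=.
    by move=> [j]; rewrite inE => /orP[/eqP->|js]; [left|right; exists j].
  by move=> [|[j js]]; [exists i; rewrite ?mem_head|exists j; rewrite ?inE ?js ?orbT].
split; first exact: measurableU.
apply: (le_trans (measureU2 P (mA i) mS)).
by rewrite /= mulrS mulrDl mul1r EFinD leeD// Ac// mem_head.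
Qed.

Definition tdot d (g z : d.-tuple R) : R := dotp (tnth g) z.

Lemma measurable_tdot d :
  measurable_fun setT (fun p : d.-tuple R * d.-tuple R => tdot p.1 p.2).
Proof.
apply: measurable_sum => i; apply: measurable_funM.
  by apply: (measurableT_comp (measurable_tnth i)) => //; exact: measurable_fst.
by apply: (measurableT_comp (measurable_tnth i)) => //; exact: measurable_snd.
Qed.

(** The directions g, not normalised, such that g / |g| has scalar product
    more than t in absolute value with z.  Squaring avoids square roots and
    makes the condition fail at g = 0. *)
Definition cap_dir d (t : R) (z : d.-tuple R) : set (d.-tuple R) :=
  [set g | t ^+ 2 * sqnorm g < tdot g z ^+ 2].

Definition covered d (t : R) (l : 'I_d -> R) : set (d.-tuple R) :=
  [set z | t < `|dotp l z|].

Lemma measurable_covered d t (l : 'I_d -> R) : measurable (covered t l).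
Proof.
apply: measurable_set_lt => //; apply: measurableT_comp => //.
exact: measurable_dotp.
Qed.

Lemma cap_dir_covered d (t : R) (g : d.-tuple R) : 0 <= t -> 0 < sqnorm g ->
  covered t (fun i => tnth g i / Num.sqrt (sqnorm g)) = [set z | cap_dir t z g].
Proof.
move=> t0 g0; have s0 : 0 < Num.sqrt (sqnorm g) by rewrite sqrtr_gt0.
rewrite /covered /cap_dir; apply/seteqP.
have E z : (t < `|dotp (fun i => tnth g i / Num.sqrt (sqnorm g)) z|) =
           (t ^+ 2 * sqnorm g < tdot g z ^+ 2).
  rewrite (_ : dotp _ z = tdot g z / Num.sqrt (sqnorm g)); last first.
    rewrite /tdot /dotp mulr_suml; apply: eq_bigr => i _; by rewrite mulrAC.
  rewrite normrM [X in _ * X]gtr0_norm ?invr_gt0// ltr_pdivlMr//.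
  rewrite -(@ltr_pXn2r _ 2)// ?nnegrE ?mulr_ge0 ?normr_ge0// ?ltW//.
  by rewrite exprMn sqr_sqrtr ?(ltW g0)// -normrX ger0_norm// sqr_ge0.
by split => z /=; rewrite E.
Qed.

Lemma sqnorm_ge0 d (g : d.-tuple R) : 0 <= sqnorm g.
Proof. by apply: sumr_ge0 => i _; exact: sqr_ge0. Qed.

Lemma sqnorm_eq0_tdot d (g z : d.-tuple R) : sqnorm g = 0 -> tdot g z = 0.
Proof.
move=> /eqP; rewrite psumr_eq0; last by move=> i _; exact: sqr_ge0.
move=> /allP g0; rewrite /tdot /dotp big1// => i _.
by have := g0 i (mem_index_enum _); rewrite sqrf_eq0 => /eqP ->; rewrite mul0r.
Qed.

Lemma sum_sqr_normalized d (g : d.-tuple R) : 0 < sqnorm g ->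
  \sum_(i < d) (tnth g i / Num.sqrt (sqnorm g)) ^+ 2 = 1.
Proof.
move=> g0; under eq_bigr do rewrite expr_div_n sqr_sqrtr ?(ltW g0)//.
by rewrite -mulr_suml divff// gt_eqF.
Qed.

(** Averaging argument: if every point of V is covered by a Gaussian random
    direction with probability at least p, then by Tonelli a random direction
    covers on average at least a fraction p of V, so some direction covers a
    fraction p / 2.  Giving up the factor 2 makes the contradiction strict. *)
Lemma exists_good_direction d (V : set (d.-tuple R)) (t p : R) :
  (0 < d)%N -> 0 <= t -> 0 < p -> measurable V ->
  (forall z, V z -> (p%:E <= std_gaussian R d (cap_dir t z))%E) ->
  exists2 l : 'I_d -> R, \sum_(i < d) l i ^+ 2 = 1 &
    ((p / 2)%:E * std_gaussian R d V <= std_gaussian R d (V `&` covered t l))%E.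
Proof.
move=> d0 t0 p0 mV hV; set P := std_gaussian R d.
have [V0|Vn0] := eqVneq (P V) 0%E.
  exists (fun i => (i == Ordinal d0)%:R); last by rewrite V0 mule0.
  exact: sum_sqr_delta.
have Vgt0 : (0 < P V)%E by rewrite lt0e Vn0/=.
have PVfin : P V \is a fin_num by rewrite fin_num_measure.
suff [g hg] : exists g, ((p / 2)%:E * P V <= P (V `&` [set z | cap_dir t z g]))%E.
  have g0 : 0 < sqnorm g.
    rewrite lt_neqAle sqnorm_ge0 andbT eq_sym; apply/eqP => g0.
    move: hg; rewrite (_ : _ `&` _ = set0) ?measure0.
      by rewrite leNgt mule_gt0// lte_fin divr_gt0.
    apply/seteqP; split => // z [_]; rewrite /cap_dir/= g0 mulr0.
    by rewrite sqnorm_eq0_tdot// expr0n ltxx.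
  exists (fun i => tnth g i / Num.sqrt (sqnorm g)).
    exact: sum_sqr_normalized.
  by rewrite cap_dir_covered.
apply/not_existsP => hn.
pose S := [set gz : d.-tuple R * d.-tuple R | V gz.2 /\ cap_dir t gz.2 gz.1].
have mS : measurable S.
  apply: measurableI.
    rewrite -[X in measurable X]setTI.
    exact: (@measurable_snd _ _ (d.-tuple R) (d.-tuple R) measurableT V mV).
  apply: measurable_set_lt.
    apply: measurable_funM => //.
    by apply: (measurableT_comp (@measurable_sqnorm R d)); exact: measurable_fst.
  by apply: measurable_funX; exact: measurable_tdot.
have mf : measurable_fun setT (fun gz : d.-tuple R * d.-tuple R => (\1_S gz : R)%:E).
  by apply/measurable_EFinP; exact: measurable_indic.
have f0 gz : (0 <= (\1_S gz : R)%:E :> \bar R)%E by rewrite lee_fin.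
have mx g : measurable [set z | S (g, z)].
  rewrite (_ : mkset _ = xsection S g); first exact: measurable_xsection.
  by apply/seteqP; split => z /=; rewrite /xsection/= inE.
have my z : measurable [set g | S (g, z)].
  rewrite (_ : mkset _ = ysection S z); first exact: measurable_ysection.
  by apply/seteqP; split => g /=; rewrite /ysection/= inE.
have := fubini_tonelli (m1 := P) (m2 := P) _ mf f0.
have -> : (\int[P]_x \int[P]_y (\1_S (x, y) : R)%:E =
    \int[P]_g P [set z | S (g, z)])%E.
  apply: eq_integral => g _.
  rewrite (_ : (fun y => _) = (fun y => (\1_[set z | S (g, z)] y : R)%:E)).
    by rewrite integral_indic// setIT.
  by apply/funext => z; rewrite !indicE.
have -> : (\int[P]_y \int[P]_x (\1_S (x, y) : R)%:E =
    \int[P]_z P [set g | S (g, z)])%E.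
  apply: eq_integral => z _.
  rewrite (_ : (fun y => _) = (fun y => (\1_[set g | S (g, z)] y : R)%:E)).
    by rewrite integral_indic// setIT.
  by apply/funext => g; rewrite !indicE.
have mPx : measurable_fun setT (fun g => P [set z | S (g, z)]).
  rewrite (_ : (fun _ => _) = P \o xsection S); first exact: measurable_fun_xsection.
  apply/funext => g /=; congr (P _).
  by apply/seteqP; split => z /=; rewrite /xsection/= inE.
have mPy : measurable_fun setT (fun z => P [set g | S (g, z)]).
  rewrite (_ : (fun _ => _) = P \o ysection S); first exact: measurable_fun_ysection.
  apply/funext => z /=; congr (P _).
  by apply/seteqP; split => g /=; rewrite /ysection/= inE.
have ub : (\int[P]_g P [set z | S (g, z)] <= (p / 2)%:E * P V)%E.
  have -> : ((p / 2)%:E * P V = \int[P]_g ((p / 2)%:E * P V))%E.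
    rewrite -[in RHS](fineK PVfin) -EFinM integral_cst//.
    rewrite EFinM fineK// -[LHS]mule1; congr (_ * _)%E.
    exact/esym/probability_setT.
  apply: ge0_le_integral => //.
  by move=> g _; apply/ltW; rewrite ltNge; apply/negP; exact: hn.
have lb : (p%:E * P V <= \int[P]_z P [set g | S (g, z)])%E.
  rewrite -integral_cst//.
  apply: (@le_trans _ _ (\int[P]_(z in V) P [set g | S (g, z)])%E).
    apply: ge0_le_integral => //.
    - by move=> z _; rewrite lee_fin ltW.
    - exact: measurable_funTS.
    - move=> z Vz; apply: (le_trans (hV z Vz)).
      rewrite le_eqVlt; apply/orP; left; apply/eqP; congr (P _).
      by apply/seteqP; split => g //= [].
  exact: ge0_subset_integral.
move=> Eq; have := lb; rewrite -Eq => /le_trans/(_ ub).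
rewrite -(fineK PVfin) -!EFinM lee_fin ler_pM2r; last by rewrite -lte_fin fineK.
by lra.
Qed.

End covering.

(** * Bounds on the quantile for large dimension *)

Section bounds.
Context {R : realType}.

(** Directions are added one at a time; each one covers at least a fraction
    p / 2 of the part of G that is still uncovered. *)
Lemma greedy_cover d (G : set (d.-tuple R)) (t p : R) :
  (0 < d)%N -> 0 <= t -> 0 < p -> p <= 2 -> measurable G ->
  (forall z, G z -> (p%:E <= std_gaussian R d (cap_dir t z))%E) ->
  forall n, exists L : {fset 'cV[R]_d},
    [/\ L != fset0, [set` L] `<=` @unit_sphere R d, (#|` L| <= n.+1)%N &
        (std_gaussian R d (G `&` [set z | (sup_abs_proj L z <= t)%R])
         <= ((1 - p / 2) ^+ n)%:E)%E].
Proof.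
move=> d0 t0 p0 p2 mG hG; elim => [|n [L [L0 Ls Ln hL]]].
  pose e : 'cV[R]_d := \col_i (i == Ordinal d0)%:R.
  exists [fset e]%fset; split.
  - by apply/fset0Pn; exists e; rewrite inE.
  - move=> l; rewrite /= inE => /eqP ->; rewrite /unit_sphere /=.
    by under eq_bigr do rewrite mxE; exact: sum_sqr_delta.
  - by rewrite cardfs1.
  - by rewrite expr0; apply: probability_le1; apply: measurableI => //;
      exact: measurable_uncovered.
pose V := G `&` [set z | sup_abs_proj L z <= t].
have mV : measurable V by apply: measurableI => //; exact: measurable_uncovered.
have [l l1 hl] := exists_good_direction d0 t0 p0 mV (fun z (Vz : V z) => hG z Vz.1).
pose lv : 'cV[R]_d := \col_i l i.
exists (lv |` L)%fset; split.
- by apply/fset0Pn; exists lv; rewrite !inE eqxx.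
- move=> k; rewrite /= !inE => /orP[/eqP ->|kL]; last exact: Ls.
  by rewrite /unit_sphere /=; under eq_bigr do rewrite mxE.
- rewrite cardfsU1; case: (lv \notin L); rewrite ?add1n ?add0n ?ltnS//.
  exact: leqW.
have mC := measurable_covered t l.
have sub : G `&` [set z | sup_abs_proj (lv |` L)%fset z <= t] `<=` V `\` (V `&` covered t l).
  move=> z [Gz /= hz]; have {}hz := (sup_abs_proj_le _ z t0).1 hz.
  have Vz : V z.
    split => //=; apply/(sup_abs_proj_le _ z t0) => k kL.
    by apply: hz; rewrite !inE kL orbT.
  split => // -[_]; rewrite /covered /= ltNge => /negP; apply.
  have := hz lv; rewrite !inE eqxx => /(_ isT).
  by rewrite /dotp; under eq_bigr do rewrite mxE.
apply: (@le_trans _ _ (std_gaussian R d (V `\` (V `&` covered t l)))).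
  apply: le_measure; rewrite ?inE => //.
  - by apply: measurableI => //; exact: measurable_uncovered.
  - by apply: measurableD => //; exact: measurableI.
have mVC : measurable (V `&` covered t l) by exact: measurableI.
have -> : std_gaussian R d (V `\` (V `&` covered t l)) =
    (std_gaussian R d V - std_gaussian R d (V `&` covered t l))%E.
  rewrite measureD//; first by rewrite setIA setIid.
  by rewrite -ge0_fin_numE// fin_num_measure.
have fV : std_gaussian R d V \is a fin_num by rewrite fin_num_measure.
have fC : std_gaussian R d (V `&` covered t l) \is a fin_num by rewrite fin_num_measure.
rewrite -(fineK fV) -(fineK fC) -EFinB lee_fin.
move: hl hL; rewrite -/V -(fineK fV) -(fineK fC) -EFinM !lee_fin => hl hL.
have q0 : 0 <= 1 - p / 2 by lra.
have := ler_wpM2l q0 hL; rewrite -exprS; apply: le_trans.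
by rewrite mulrBl mul1r lerB.
Qed.

Lemma near_expR_decay (C r eps : R) : 0 < C -> 0 < r -> 0 < eps ->
  \forall d \near \oo, C * expR (- r * d%:R) <= eps.
Proof.
move=> C0 r0 e0; near=> d.
rewrite mulNr expRN ler_pdivrMr ?expR_gt0// -ler_pdivrMl//.
apply: le_trans (expR_ge1Dx _).
rewrite -lerBlDl -ler_pdivrMl//.
by near: d; exact: nbhs_infty_ger.
Unshelve. all: by end_near. Qed.

(** Union bound.  Outside a negligible event the squared norm of Z is at most
    (1 + eta) d, and then each of the at most exp (d b) directions exceeds
    kappa sqrt d with probability at most about exp (- d b0), where
    b0 = - ln (1 - kappa ^ 2) / 2 > b. *)
Lemma near_K_le (kappa b alpha : R) : 0 <= kappa -> kappa < 1 ->
  b < - (ln (1 - kappa ^+ 2) / 2) -> 0 < alpha -> alpha < 1 ->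
  \forall d \near \oo, forall L : {fset 'cV[R]_d},
    [set` L] `<=` @unit_sphere R d -> (#|` L|)%:R <= expR (d%:R * b) ->
    K L alpha <= kappa * Num.sqrt d%:R.
Proof.
move=> k0 k1 hb a0 a1.
set b0 := - _ in hb; set s := tilt_var_inv kappa.
have s0 : 0 < s := tilt_var_inv_gt0 k0 k1.
have s1 : 0 <= s - 1.
  by rewrite -(tilt_var_invM k0 k1) mulr_ge0 ?sqr_ge0// ltW.
pose gap := b0 - b; have gap0 : 0 < gap by rewrite subr_gt0.
pose eta := Num.min 2^-1 (gap / s).
have eta0 : 0 < eta by rewrite lt_min invr_gt0 ltr0n/= divr_gt0.
have eta1 : eta < 1 by rewrite gt_min invf_lt1// ltr1n.
have etas : (s - 1) * eta <= gap.
  apply: (@le_trans _ _ (s * eta)); first by rewrite ler_wpM2r ?gerBl// ltW.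
  by rewrite mulrC -ler_pdivlMr// ge_min lexx orbT.
have [r r0 hr] := sqnorm_concentration eta0 eta1.
near=> d => L Ls Lb.
have d0 : (0 < d)%N by near: d; exact: nbhs_infty_gt.
set P := std_gaussian R d.
set q := Num.sqrt d%:R; have q0 : 0 <= kappa * q by rewrite mulr_ge0// sqrtr_ge0.
apply: K_le => //.
set U := mkset _.
have mU : measurable U by exact: measurable_uncovered.
suff h : (P (~` U) <= alpha%:E)%E.
  rewrite -(setCK U) probability_setC; last exact: measurableC.
  have fU : P (~` U) \is a fin_num by rewrite fin_num_measure//; exact: measurableC.
  by move: h; rewrite -/P -(fineK fU) -EFinB !lee_fin => h; rewrite lerB.
pose N : set (d.-tuple R) := ~` [set t | `|sqnorm t - d%:R| < eta * d%:R].
pose B (u : 'I_d -> R) : set (d.-tuple R) :=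
  [set t | kappa * q <= dotp u t /\ sqnorm t <= (1 + eta) * d%:R].
pose A (l : 'cV[R]_d) := B (fun i => l i 0) `|` B (fun i => - l i 0).
have mB u : measurable (B u).
  apply: measurableI; apply: measurable_set_le => //.
  - exact: measurable_dotp.
  - exact: measurable_sqnorm.
have mA l : measurable (A l) by exact: measurableU.
have mN : measurable N by apply: measurableC; exact: measurable_sqnorm_near.
set c := expR (d%:R / 2 * ((s - 1) * (1 + eta - 1) + ln (1 - kappa ^+ 2))).
have PB u : \sum_(i < d) u i ^+ 2 = 1 -> (P (B u) <= c%:E)%E.
  by move=> u1; exact: dotp_tail_bound.
have PA l : l \in enum_fset L -> (P (A l) <= (2 * c)%:E)%E.
  move=> lL; have l1 : \sum_(i < d) l i 0 ^+ 2 = 1 by exact: (Ls l lL).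
  apply: (le_trans (measureU2 P (mB _) (mB _))).
  rewrite mulrDl mul1r EFinD leeD// PB//.
  by under eq_bigr do rewrite sqrrN.
have [mS PS] := measure_exists_seq_le mA PA.
have sub : ~` U `<=` N `|` [set x | exists2 l, l \in enum_fset L & A l x].
  move=> z /= Uz; have [Nz|Nz] := pselect (N z); [by left|right].
  move/contrapT : Nz; rewrite /= ltr_distl => /andP[_ /ltW z2].
  apply: contrapT => h; apply: Uz; apply/(sup_abs_proj_le _ z q0) => l lL.
  rewrite leNgt; apply/negP; rewrite ltr_normr => /orP hl; apply: h; exists l => //.
  case: hl => /ltW hl; [left|right]; split; rewrite ?mulrDl ?mul1r//.
  apply: (le_trans hl); rewrite /dotp -sumrN le_eqVlt; apply/orP; left; apply/eqP.
  by apply: eq_bigr => i _; rewrite mulNr.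
apply: (@le_trans _ _ (P (N `|` [set x | exists2 l, l \in enum_fset L & A l x]))).
  apply: le_measure; rewrite ?inE//; first exact: measurableC.
  exact: measurableU.
apply: (le_trans (measureU2 P mN mS)).
apply: (le_trans (leeD (hr d d0) PS)); rewrite -EFinD lee_fin.
have h1 : 4 * expR (- r * d%:R) <= alpha / 2.
  by near: d; apply: near_expR_decay => //; rewrite divr_gt0.
have h2 : 2 * expR (- (gap / 2) * d%:R) <= alpha / 2.
  by near: d; apply: near_expR_decay => //; rewrite divr_gt0.
rewrite [leRHS]splitr lerD//; apply: le_trans h2.
have cE : c <= expR (d%:R / 2 * (gap - 2 * b0)).
  rewrite ler_expR ler_wpM2l ?divr_ge0// /b0 addrAC subrr add0r.
  by apply: lerD => //; rewrite mulrN opprK mulrC divfK.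
have c0 : 0 <= 2 * c by rewrite mulr_ge0// expR_ge0.
apply: (le_trans (ler_wpM2r c0 Lb)).
rewrite mulrCA ler_wpM2l//.
apply: (le_trans (ler_wpM2l (expR_ge0 _) cE)).
rewrite -expRD ler_expR le_eqVlt; apply/orP; left; apply/eqP.
by rewrite /gap; field.
Unshelve. all: by end_near. Qed.

End bounds.

Section lower.
Context {R : realType}.

(** Up to errors of relative size eta, z and g have norm sqrt d, and the
    component of g along z is m sqrt d; the condition 3 eta <= m - kappa
    absorbs all the errors. *)
Lemma typical_sub_cap_dir d (m eta kappa : R) (z : d.-tuple R) :
  0 <= kappa -> m < 1 -> 0 < eta -> eta < 1 -> 3 * eta <= m - kappa ->
  (0 < d)%N -> `|sqnorm z - d%:R| < eta * d%:R ->
  typical m (fun i => tnth z i / Num.sqrt (sqnorm z)) eta `<=`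
  cap_dir (kappa * Num.sqrt d%:R) z.
Proof.
move=> k0 m1 e0 e1 e3 d0; rewrite ltr_distl => /andP[zl _] g [].
set q := Num.sqrt d%:R; have q2 : q ^+ 2 = d%:R by rewrite sqr_sqrtr.
have q0 : 0 <= q by exact: sqrtr_ge0.
have dR0 : 0 < d%:R :> R by rewrite ltr0n.
set x := dotp _ g; rewrite !ltr_distl => /andP[xl _] /andP[_ gl].
have z0 : 0 < sqnorm z.
  by apply: lt_trans zl; rewrite -[X in X - _]mul1r -mulrBl mulr_gt0// subr_gt0.
have xE : tdot g z ^+ 2 = sqnorm z * x ^+ 2.
  have -> : tdot g z = x * Num.sqrt (sqnorm z).
    rewrite /x /tdot /dotp mulr_suml; apply: eq_bigr => i _.
    by rewrite mulrAC divfK 1?mulrC// gt_eqF// sqrtr_gt0.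
  by rewrite exprMn sqr_sqrtr ?(ltW z0)// mulrC.
rewrite /cap_dir /= xE exprMn q2.
have x2 : (m - eta) ^+ 2 * d%:R <= x ^+ 2.
  rewrite -q2 -exprMn ler_pXn2r// ?nnegrE.
  - by rewrite mulrBl ltW.
  - by rewrite mulr_ge0//; lra.
  - by apply: le_trans (ltW xl); rewrite -mulrBl mulr_ge0//; lra.
have cmp : kappa ^+ 2 * (1 + eta) <= (1 - eta) * (m - eta) ^+ 2.
  have h1 : kappa * (1 + eta) <= (1 - eta) * (m - eta) by nra.
  have h2 : kappa <= m - eta by lra.
  rewrite !expr2 mulrAC mulrA ler_pM// mulr_ge0//; lra.
(* kappa = 0 is separate: strictness then comes from the right-hand side *)
have [k00|kn0] := eqVneq kappa 0.
  rewrite k00 expr0n/= !mul0r mulr_gt0//; apply: lt_le_trans x2.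
  by rewrite mulr_gt0// exprn_gt0//; lra.
have kp : 0 < kappa ^+ 2 * d%:R by rewrite mulr_gt0// exprn_gt0// lt_neqAle eq_sym kn0.
apply: (@lt_le_trans _ _ (kappa ^+ 2 * d%:R * ((1 + eta) * d%:R))).
  by rewrite ltr_pM2l// mulrDl mul1r.
apply: (@le_trans _ _ (((1 - eta) * d%:R) * ((m - eta) ^+ 2 * d%:R))); last first.
  apply: ler_pM => //.
  - by rewrite mulr_ge0//; lra.
  - by rewrite mulr_ge0// sqr_ge0.
  - by rewrite mulrBl mul1r ltW.
have -> : kappa ^+ 2 * d%:R * ((1 + eta) * d%:R) =
    kappa ^+ 2 * (1 + eta) * d%:R ^+ 2 by ring.
have -> : (1 - eta) * d%:R * ((m - eta) ^+ 2 * d%:R) =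
    (1 - eta) * (m - eta) ^+ 2 * d%:R ^+ 2 by ring.
by rewrite ler_wpM2r// sqr_ge0.
Qed.

(** Let b0 = - ln (1 - m ^ 2) / 2.  For large d a random direction covers a
    given point of norm about sqrt d with probability at least
    p = exp (- d (b0 + b) / 2) / 2.  As b > b0, about exp (d b) greedy steps
    leave uncovered a part of measure at most exp (- p exp (d b) / 4), which
    tends to 0. *)
Lemma near_K_ge (kappa m b alpha : R) : 0 <= kappa -> kappa < m -> m < 1 ->
  - (ln (1 - m ^+ 2) / 2) < b -> 0 < alpha -> alpha < 1 ->
  \forall d \near \oo, forall x : R, expR (d%:R * b) <= x ->
    exists L : {fset 'cV[R]_d},
    [/\ L != fset0, [set` L] `<=` @unit_sphere R d, (#|` L|)%:R <= x &
        kappa * Num.sqrt d%:R <= K L alpha].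
Proof.
move=> k0 km m1 hb a0 a1.
have m0 : 0 <= m by apply: le_trans (ltW km).
set b0 := - _ in hb; set s := tilt_var_inv m.
have s0 : 0 < s := tilt_var_inv_gt0 m0 m1.
have b00 : 0 <= b0.
  rewrite oppr_ge0 pmulr_lle0 ?invr_gt0//; apply: ln_le0.
  by rewrite gerBl sqr_ge0.
have bgt0 : 0 < b by exact: le_lt_trans hb.
pose gap := b - b0; have gap0 : 0 < gap by rewrite subr_gt0.
pose eta := Num.min 2^-1 (Num.min ((m - kappa) / 3) (gap / (4 * s))).
have eta0 : 0 < eta.
  rewrite !lt_min invr_gt0 ltr0n/=; apply/andP; split; apply: divr_gt0 => //.
    by rewrite subr_gt0.
  exact: mulr_gt0.
have eta1 : eta < 1 by rewrite gt_min invf_lt1// ltr1n.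
have eta3 : 3 * eta <= m - kappa.
  by rewrite mulrC -ler_pdivlMr// !ge_min lexx orbT.
have etas : s * eta * (m + m ^+ 2 / 2) <= gap / 2.
  have h : s * eta <= gap / 4.
    have : eta <= gap / (4 * s) by rewrite !ge_min lexx !orbT.
    by rewrite !ler_pdivlMr ?mulr_gt0//; lra.
  have h' : m + m ^+ 2 / 2 <= 2.
    have : m ^+ 2 <= 1 by rewrite expr_le1// ltW.
    by lra.
  have g4 : 0 <= gap / 4 by rewrite divr_ge0// ltW.
  apply: (@le_trans _ _ (gap / 4 * 2)); last by lra.
  apply: ler_pM => //; first by rewrite mulr_ge0// ltW.
  by rewrite addr_ge0// divr_ge0// sqr_ge0.
have [r r0 hr] := sqnorm_concentration eta0 eta1.
have beta0 : 0 < (1 - alpha) / 4 by rewrite divr_gt0// subr_gt0.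
have typ := typical_lower_bound m0 m1 eta0 eta1.
near=> d => x hx.
have d0 : (0 < d)%N by near: d; exact: nbhs_infty_gt.
set P := std_gaussian R d.
set t := kappa * Num.sqrt d%:R.
have t0 : 0 <= t by rewrite mulr_ge0// sqrtr_ge0.
pose G : set (d.-tuple R) := [set z | `|sqnorm z - d%:R| < eta * d%:R].
have mG : measurable G by exact: measurable_sqnorm_near.
pose p := 2^-1 * expR (d%:R * (- b0 - gap / 2)).
have p0 : 0 < p by rewrite mulr_gt0 ?invr_gt0// expR_gt0.
have p2 : p <= 2.
  have : expR (d%:R * (- b0 - gap / 2)) <= 1.
    rewrite -[leRHS]expR0 ler_expR mulr_ge0_le0//; lra.
  by rewrite /p; lra.
have hG z : G z -> (p%:E <= P (cap_dir t z))%E.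
  move=> Gz.
  have z0 : 0 < sqnorm z.
    move: Gz; rewrite /G /= ltr_distl => /andP[zl _]; apply: lt_trans zl.
    by rewrite -[X in X - _]mul1r -mulrBl mulr_gt0 ?ltr0n// subr_gt0.
  pose u (i : 'I_d) := tnth z i / Num.sqrt (sqnorm z).
  have u1 : \sum_(i < d) u i ^+ 2 = 1 by exact: sum_sqr_normalized.
  apply: (@le_trans _ _ (P (typical m u eta))).
    have td : forall u : 'I_d -> R, \sum_(i < d) u i ^+ 2 = 1 ->
      ((2^-1 * expR (d%:R * (ln (1 - m ^+ 2) / 2 -
         tilt_var_inv m * eta * (m + m ^+ 2 / 2))))%:E <=
         std_gaussian R d (typical m u eta))%E by near: d.
    apply: le_trans (td u u1); rewrite lee_fin ler_wpM2l// ler_expR ler_wpM2l//.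
    by rewrite /b0 opprK lerB.
  apply: le_measure; rewrite ?inE.
  - exact: measurable_typical.
  - apply: measurable_set_lt.
      by apply: measurable_funM => //; exact: measurable_sqnorm.
    apply: measurable_funX; apply: measurable_sum => i.
    by apply: measurable_funM => //; exact: measurable_tnth.
  - exact: typical_sub_cap_dir.
have x4 : 4 <= x.
  apply: le_trans hx; apply: le_trans (expR_ge1Dx _).
  rewrite -lerBlDl -ler_pdivrMr//.
  by near: d; exact: nbhs_infty_ger.
have x0 : 0 <= x by apply: le_trans x4.
have /andP[N1 N2] := truncn_itv x0.
set N := Num.truncn x in N1 N2.
(* N.-1 steps, since the greedy family starts from one vector *)
have [L [L0 Ls Ln hL]] := greedy_cover d0 t0 p0 p2 mG hG N.-1.
have Npos : (0 < N)%N.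
  rewrite lt0n; apply/eqP => N0; move: N2; rewrite N0 ltNge => /negP; apply.
  by apply: le_trans x4; clear; lra.
exists L; split => //.
  by apply: le_trans N1; rewrite ler_nat; rewrite prednK in Ln.
apply: K_ge => //.
set U := mkset _; have mU : measurable U by exact: measurable_uncovered.
have mGU : measurable (G `&` U) by exact: measurableI.
have mGC : measurable (~` G) by exact: measurableC.
apply: (@le_lt_trans _ _ (P (~` G `|` G `&` U))).
  apply: le_measure; rewrite ?inE//; first exact: measurableU.
  by move=> z Uz; have [Gz|Gz] := pselect (G z); [right|left].
apply: (le_lt_trans (measureU2 P mGC mGU)).
apply: (le_lt_trans (leeD (hr d d0) hL)); rewrite -EFinD lte_fin.
have h1 : 4 * expR (- r * d%:R) <= (1 - alpha) / 4.
  by near: d; apply: near_expR_decay.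
have h2 : 1 * expR (- (gap / 16) * d%:R) <= (1 - alpha) / 4.
  by near: d; apply: near_expR_decay => //; rewrite divr_gt0.
suff h3 : (1 - p / 2) ^+ N.-1 <= expR (- (gap / 16) * d%:R).
  rewrite mul1r in h2; apply: (le_lt_trans (lerD h1 (le_trans h3 h2))).
  by clear -a1; lra.
have q0 : 0 <= 1 - p / 2 by clear -p2; lra.
have hq : 1 - p / 2 <= expR (- (p / 2)) by exact: expR_ge1Dx.
apply: (@le_trans _ _ (expR (- (p / 2)) ^+ N.-1)).
  by rewrite lerXn2r// nnegrE ?expR_ge0.
rewrite -expRM_natl ler_expR mulrN mulNr lerN2.
have hN : x / 2 <= N.-1%:R.
  have NE : N.+1 = (N.-1 + 2)%N by rewrite addn2 prednK.
  by move: N2 x4; rewrite NE natrD; clear; lra.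
have hxp : expR (d%:R * (gap / 2)) / 8 <= x / 2 * (p / 2).
  have -> : x / 2 * (p / 2) = x * expR (d%:R * (- b0 - gap / 2)) / 8.
    by rewrite /p; field.
  have -> : d%:R * (gap / 2) = d%:R * b + d%:R * (- b0 - gap / 2).
    by rewrite /gap; field.
  by rewrite ler_wpM2r// expRD ler_wpM2r// expR_ge0.
apply: (@le_trans _ _ (x / 2 * (p / 2))); last first.
  by rewrite ler_wpM2r// divr_ge0// ltW.
apply: le_trans hxp; have := expR_ge1Dx (d%:R * (gap / 2)).
by clear; lra.
Unshelve. all: by end_near. Qed.

End lower.

(** * The limit *)

Section growth.
Context {R : realType}.

(** Taking logarithms, the hypothesis says that ln (a_ d) / d tends to ln a. *)
Lemma near_growth (a_ : nat -> R) (a : R) :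
  (forall d : nat, (1 <= d)%N -> 0 < a_ d) ->
  (fun d : nat => a_ d `^ (d%:R)^-1) @ \oo --> a -> 0 < a ->
  (forall b, ln a < b -> \forall d \near \oo, a_ d <= expR (d%:R * b)) /\
  (forall b, b < ln a -> \forall d \near \oo, expR (d%:R * b) <= a_ d).
Proof.
move=> a_pos a_cvg a0.
have E d : (0 < d)%N -> a_ d = expR (d%:R * (ln (a_ d) / d%:R)) /\
    a_ d `^ (d%:R)^-1 = expR (ln (a_ d) / d%:R).
  move=> d0; split; last by rewrite /powR gt_eqF ?a_pos// mulrC.
  by rewrite mulrCA divff ?mulr1 ?lnK ?posrE ?a_pos// pnatr_eq0 -lt0n.
split=> b hb.
  have hb' : a < expR b by rewrite -[a]lnK ?posrE// ltr_expR.
  near=> d; have d0 : (0 < d)%N by near: d; exact: nbhs_infty_gt.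
  have : a_ d `^ (d%:R)^-1 < expR b by near: d; exact: (cvgr_lt a).
  rewrite (E d d0).2 ltr_expR => h; rewrite (E d d0).1 ler_expR.
  by rewrite ler_wpM2l// ltW.
have hb' : expR b < a by rewrite -[a]lnK ?posrE// ltr_expR.
near=> d; have d0 : (0 < d)%N by near: d; exact: nbhs_infty_gt.
have : expR b < a_ d `^ (d%:R)^-1 by near: d; exact: (cvgr_gt a).
rewrite (E d d0).2 ltr_expR => h; rewrite (E d d0).1 ler_expR.
by rewrite ler_wpM2l// ltW.
Unshelve. all: by end_near. Qed.

Lemma cvg_ereal_near (f : nat -> \bar R) (c : R) :
  (forall e, 0 < e -> \forall d \near \oo, (f d <= (c + e)%:E)%E) ->
  (forall e, 0 < e -> \forall d \near \oo, ((c - e)%:E <= f d)%E) ->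
  f @ \oo --> c%:E.
Proof.
move=> ub lb; apply/fine_cvgP.
have fin : \forall d \near \oo, f d \is a fin_num.
  near=> d; rewrite fin_real//; apply/andP; split.
    apply: (@lt_le_trans _ _ (c - 1)%:E); first exact: ltNyr.
    by near: d; exact: lb.
  apply: (@le_lt_trans _ _ (c + 1)%:E); last exact: ltry.
  by near: d; exact: ub.
split=> //; apply/cvgrPdist_le => e e0; near=> d.
have fd : f d \is a fin_num by near: d.
have h1 : (f d <= (c + e)%:E)%E by near: d; exact: ub.
have h2 : ((c - e)%:E <= f d)%E by near: d; exact: lb.
by move: h1 h2; rewrite /= -(fineK fd) !lee_fin distrC ler_distl => -> ->.
Unshelve. all: by end_near. Qed.

(** The value c = sqrt (1 - 1 / a ^ 2) is where the rate - ln (1 - k ^ 2) / 2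
    of a cap of height k equals the growth rate ln a of the families. *)
Lemma half_ln_onem_sqr (a k c : R) : 0 < a -> 0 <= c -> c ^+ 2 = 1 - 1 / a ^+ 2 ->
  0 <= k -> k < 1 ->
  (c < k -> ln a < - (ln (1 - k ^+ 2) / 2)) /\
  (k < c -> - (ln (1 - k ^+ 2) / 2) < ln a).
Proof.
move=> a0 c0 c2 k0 k1.
have kp : 0 < 1 - k ^+ 2 by exact: onem_sqr_gt0.
have cE : 1 - c ^+ 2 = (a ^+ 2)^-1 by rewrite c2 div1r opprB addrC subrK.
have lnc : ln (1 - c ^+ 2) = - (ln a *+ 2).
  by rewrite cE lnV ?lnXn// posrE exprn_gt0.
have cp : 0 < 1 - c ^+ 2 by rewrite cE invr_gt0 exprn_gt0.
split=> h.
  have : ln (1 - k ^+ 2) < ln (1 - c ^+ 2).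
    by rewrite ltr_ln ?posrE// ltrD2l ltrN2 ltr_pXn2r// ?nnegrE.
  by rewrite lnc mulr2n; lra.
have : ln (1 - c ^+ 2) < ln (1 - k ^+ 2).
  by rewrite ltr_ln ?posrE// ltrD2l ltrN2 ltr_pXn2r// ?nnegrE.
by rewrite lnc mulr2n; lra.
Qed.

End growth.

(* The supremum is taken in \bar R, so boundedness of the ratios is part of the
   claim; it is -oo for the finitely many d whose family is empty. *)
Theorem theorem6p3 (R : realType) (a_ : nat -> R) (a alpha : R)
    (a_pos : forall d : nat, (1 <= d)%N -> 0 < a_ d)
    (a_cvg : (fun d : nat => a_ d `^ (d%:R)^-1) @ \oo --> a)
    (a_gt1 : 1 < a) (alpha_gt0 : 0 < alpha) (alpha_lt1 : alpha < 1) :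
  (fun d : nat =>
     ereal_sup [set (K L alpha / Num.sqrt d%:R)%:E |
       L in [set L : {fset 'cV[R]_d} |
               L != fset0 /\ [set` L] `<=` @unit_sphere R d /\
               (#|` L|)%:R <= a_ d]]) @ \oo
  --> (Num.sqrt (1 - 1 / a ^+ 2))%:E.
Proof.
have a0 : 0 < a by exact: lt_trans a_gt1.
have [above below] := near_growth a_pos a_cvg a0.
have ia : 0 < 1 - 1 / a ^+ 2.
  by rewrite subr_gt0 ltr_pdivrMr ?exprn_gt0// mul1r exprn_egt1.
set c := Num.sqrt _; have c0 : 0 < c by rewrite sqrtr_gt0.
have c2 : c ^+ 2 = 1 - 1 / a ^+ 2 by rewrite sqr_sqrtr// ltW.
have c1 : c < 1.
  by rewrite -(@ltr_pXn2r _ 2)// ?nnegrE ?ltW// expr1n c2 gtrBl divr_gt0// exprn_gt0.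
apply: cvg_ereal_near => e e0.
  (* a level in ]c, c + e], and below 1 because its cap must not be empty *)
  pose k := c + Num.min ((1 - c) / 2) e.
  have ck : c < k by rewrite ltrDl lt_min e0 divr_gt0// subr_gt0.
  have k1 : k < 1.
    have : Num.min ((1 - c) / 2) e <= (1 - c) / 2 by rewrite ge_min lexx.
    by rewrite /k; lra.
  have k0 : 0 <= k by apply: ltW; apply: lt_trans ck.
  have /(_ ck) := (half_ln_onem_sqr a0 (ltW c0) c2 k0 k1).1.
  set b0 := - _ => hb.
  have [hb1 hb2] := midf_lt hb.
  have ev := near_K_le k0 k1 hb2 alpha_gt0 alpha_lt1.
  near=> d; apply: ub_ereal_sup => _ [L [_ [Ls Lc]] <-].
  have d0 : (0 < d)%N by near: d; exact: nbhs_infty_gt.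
  have q0 : 0 < Num.sqrt d%:R :> R by rewrite sqrtr_gt0 ltr0n.
  rewrite lee_fin ler_pdivrMr//; apply: (@le_trans _ _ (k * Num.sqrt d%:R)).
    have evd : forall L : {fset 'cV[R]_d}, [set` L] `<=` @unit_sphere R d ->
       (#|` L|)%:R <= expR (d%:R * ((ln a + b0) / 2)) ->
       K L alpha <= k * Num.sqrt d%:R by near: d.
    apply: evd => //; apply: (le_trans Lc).
    by near: d; exact: above.
  by rewrite ler_wpM2r ?(ltW q0)// lerD2l ge_min lexx orbT.
pose k := c - Num.min (c / 2) e.
have kc : k < c by rewrite gtrBl lt_min e0 divr_gt0.
have k0 : 0 <= k.
  have : Num.min (c / 2) e <= c / 2 by rewrite ge_min lexx.
  by rewrite /k; lra.
have [km mc] := midf_lt kc.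
set m := (k + c) / 2 in km mc.
have m1 : m < 1 by exact: lt_trans c1.
have m0 : 0 <= m by apply: le_trans (ltW km).
have /(_ mc) := (half_ln_onem_sqr a0 (ltW c0) c2 m0 m1).2.
set b0 := - _ => hb.
have [hb1 hb2] := midf_lt hb.
have ev := near_K_ge k0 km m1 hb1 alpha_gt0 alpha_lt1.
near=> d.
have d0 : (0 < d)%N by near: d; exact: nbhs_infty_gt.
have q0 : 0 < Num.sqrt d%:R :> R by rewrite sqrtr_gt0 ltr0n.
have evd : forall x : R, expR (d%:R * ((b0 + ln a) / 2)) <= x ->
    exists L : {fset 'cV[R]_d},
    [/\ L != fset0, [set` L] `<=` @unit_sphere R d, (#|` L|)%:R <= x &
        k * Num.sqrt d%:R <= K L alpha] by near: d.
have /evd[L [Lne Ls Lc LK]] : expR (d%:R * ((b0 + ln a) / 2)) <= a_ d.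
  by near: d; exact: below.
apply: (@le_trans _ _ (K L alpha / Num.sqrt d%:R)%:E); last first.
  by apply: ereal_sup_ubound; exists L.
rewrite lee_fin ler_pdivlMr//; apply: le_trans LK.
by rewrite ler_wpM2r ?(ltW q0)// lerD2l lerN2 ge_min lexx orbT.
Unshelve. all: by end_near. Qed.
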